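(* Let $p$ be an odd prime, $k_1,k_2\in\mathbb{Q}$ with $k_1+k_2\neq 0$, and $$(z_1,z_2)=\left(\frac{4k_1k_2}{(k_1+k_2)^2},\ -\frac{(k_1^2-1)(k_2^2-1)}{(k_1+k_2)^2}\right).$$ Then $$\sum_{m+n=\frac{p-1}{2}}\ \sum_{i+j+k+\ell=\frac{p-1}{2}}\binom{\frac{p-1}{2}}{i\; j\; k\; \ell}\binom{\frac{p-1}{2}}{m-i\;\; m-j\;\; n-k\;\; n-\ell}(k_1^2)^i(k_2^2)^j(k_1^2k_2^2)^k$$ $$\equiv(-1)^{\frac{p-1}{2}}\sum_{i+j+k=\frac{p-1}{2}}\binom{\frac{p-1}{2}}{i\; j\; k}\binom{\frac{p-1}{2}}{i}\binom{\frac{p-1}{2}}{j}z_1^i z_2^j \mod p,$$ where both sides evaluate to the same element of $\mathbb{F}_p$ whenever well defined.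
   Context: All summation indices are non-negative integers. For $a_1+\cdots+a_r=N$, $\binom{N}{a_1\; a_2\;\cdots\; a_r}=\frac{N!}{a_1!\,a_2!\cdots a_r!}$ is the multinomial coefficient, taken to be $0$ if some $a_s$ is negative. ''Well defined'' means that $k_1,k_2,z_1,z_2$ have denominators prime to $p$, so that both sides can be reduced modulo $p$. *)

(* Defs.v *)
From mathcomp Require Import all_boot all_order all_algebra.

Set Implicit Arguments.
Unset Strict Implicit.
Unset Printing Implicit Defensive.

Import Order.TTheory GRing.Theory Num.Theory.
Local Open Scope ring_scope.

(* The lower entries are integers, so that the coefficient vanishes as soon as
   one of them is negative.  It is meant for entries summing to N; the natural
   division is then exact. *)
Definition multinomial (N : nat) (s : seq int) : nat :=
  if all (fun a => 0 <= a) s then (N`! %/ \prod_(a <- s) `|a|`!)%N else 0%N.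

Definition p_integral (p : nat) (x : rat) : bool := coprime p `|denq x|.

(* Equality of the reductions of x and y from Z_(p) to 'F_p: for p prime,
   [ratr x : 'F_p] is the numerator of x divided in 'F_p by its denominator,
   and the latter is invertible exactly when x is p-integral. *)
Definition eq_modp (p : nat) (x y : rat) : Prop :=
  [/\ p_integral p x, p_integral p y & ratr x = ratr y :> 'F_p].

(* For h = (p - 1) / 2, the two sides of the congruence. *)
Definition lhs_sum (h : nat) (k1 k2 : rat) : rat :=
  \sum_(m < h.+1) \sum_(n < h.+1 | (m + n == h)%N)
    \sum_(i < h.+1) \sum_(j < h.+1) \sum_(k < h.+1)
      \sum_(l < h.+1 | (i + j + k + l == h)%N)
        (multinomial h [:: i%:Z; j%:Z; k%:Z; l%:Z])%:R
        * (multinomial h [:: m%:Z - i%:Z; m%:Z - j%:Z;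
                             n%:Z - k%:Z; n%:Z - l%:Z])%:R
        * (k1 ^+ 2) ^+ i * (k2 ^+ 2) ^+ j * (k1 ^+ 2 * k2 ^+ 2) ^+ k.

Definition rhs_sum (h : nat) (z1 z2 : rat) : rat :=
  (-1) ^+ h *
  \sum_(i < h.+1) \sum_(j < h.+1) \sum_(k < h.+1 | (i + j + k == h)%N)
    (multinomial h [:: i%:Z; j%:Z; k%:Z])%:R
    * 'C(h, i)%:R * 'C(h, j)%:R * z1 ^+ i * z2 ^+ j.

(* Main.v *)
Require Import Defs.
From mathcomp Require Import all_boot all_order all_algebra.
From mathcomp Require Import finfield zify ring.

(** Write [h = (p - 1) / 2] and [H(t) = \sum_i 'C(h, i)^2 t^i], the Hasse
    polynomial of the Legendre family of elliptic curves.  Both sides of the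
    congruence reduce to the product [H(k1^2) H(k2^2)].

    The left-hand side equals this product over the rationals
    ([lhs_sum_hasse]).  For fixed [i, j, k, l] the sum over [m + n = h] is a
    Vandermonde convolution with value ['C(h, i + k) * 'C(h, j + k)].  With
    [a = i + k] and [b = j + k] fixed, only the multinomial coefficient of
    [i, j, k, l] still varies with [k], and a second Vandermonde convolution
    sums it to ['C(h, a) * 'C(h, b)].

    The right-hand side is, modulo [p] and up to sign, a truncated Appell
    series F2.  Since
    [H(t) = (1 - t)^h P_h((1 + t) / (1 - t))], with [P_h] the Legendre
    polynomial, the product formula for Legendre polynomials, i.e. the
    averaged form of their addition theorem, applies.  In polynomial form
    ([hasse_mul]) it reads
      H(s) H(t) = \sum_j 'C(h, j) 'C(h + j, j) ((1 - s) (1 - t))^(h - j) W_j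
    where [W_j] is the coefficient of ['X^j] in
    [((1 + s 'X) (1 + t 'X))^j].  Its combinatorial core is the Saalschutz
    type identity [legendre_linearization].  At [s = x^2], [t = y^2], the
    factorisation
      (1 + x^2 'X) (1 + y^2 'X) = (x + y)^2 'X + (1 - x y 'X)^2
    expands [W_j] in powers of [(x + y)^2] and [- x y] with central binomial
    coefficients ([central_coef_sqr]).

    Modulo [p] one has [2 h = -1], so ['C(h + j, j)] becomes
    [(-1)^j 'C(h, j)] and ['C(2 i, i)] becomes [(-4)^i 'C(h, i)].  Multiplying
    or dividing by [((x + y)^2)^h = (x + y)^(p - 1) = 1] then gives exactly
    the right-hand side ([hasse_mul_pchar]).  Here [k1 + k2] is a unit modulo
    [p], for otherwise the integrality of [z1] would force [p] to divide [k1]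
    and [k2], against that of [z2]. *)

Set Implicit Arguments.
Unset Strict Implicit.
Unset Printing Implicit Defensive.

Import Order.TTheory GRing.Theory Num.Theory.
Local Open Scope ring_scope.

(** * Linearization of products of Legendre coefficients *)

(** The coefficients of the shifted Legendre polynomial [P_h(1 + 2 X)]. *)
Definition legendre_coef (h j : nat) : nat := 'C(h, j) * 'C(h + j, j).

Lemma legendre_coefS h j :
  (j.+1 ^ 2 * legendre_coef h j.+1 = (h - j) * (h + j).+1 * legendre_coef h j)%N.
Proof.
rewrite /legendre_coef.
have e1 := mul_bin_left h j; have := mul_bin_diag (h + j).+1 j.
rewrite addnS /= => e2; nia.
Qed.

(** The recurrence that drives the induction on [b] below.  After the common
    factor ['C(j.+1, a) * 'C(j.+1, b)] is pulled out it is Pascal's rule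
    combined with [j.+1 * 'C(a + b, j.+1) = (a + b - j) * 'C(a + b, j)]. *)
Lemma linearization_coefS a b j :
  (b.+1 ^ 2 * ('C(j.+1, a) * 'C(j.+1, b.+1) * 'C(a + b.+1, j.+1))
   = j.+1 ^ 2 * ('C(j, a) * 'C(j, b) * 'C(a + b, j))
     + (j.+1 - b) * (j + b).+2 * ('C(j.+1, a) * 'C(j.+1, b) * 'C(a + b, j.+1)))%N.
Proof.
have e1 := mul_bin_left j.+1 b.
have e2 := mul_bin_down j.+1 a.
have e3 := mul_bin_down j.+1 b.
have e4 := mul_bin_left (a + b) j.
rewrite /= in e2 e3.
have [ltj|leaj] := ltnP j.+1 a.
  rewrite !(bin_small ltj) (@bin_small j a) ?(ltnW ltj) //; last lia.
have [ltj|lebj] := ltnP j.+1 b.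
  by rewrite (@bin_small j b) ?(@bin_small j.+1 b) ?(@bin_small j.+1 b.+1) //; lia.
have [lt|le] := ltnP (a + b) j.
  by rewrite (@bin_small (a+b) j) ?(@bin_small (a+b) j.+1) ?(@bin_small (a+b.+1) j.+1) //; lia.
rewrite addnS binS.
set x := 'C(j.+1, a) in e2 *; set y := 'C(j.+1, b) in e1 e3 *.
set x' := 'C(j, a) in e2 *; set y' := 'C(j, b) in e3 *.
set z := 'C(j.+1, b.+1) in e1 *; set u := 'C(a + b, j) in e4 *.
set v := 'C(a + b, j.+1) in e4 *.
have [s Es] : exists s, (j.+1 = a + s)%N by exists (j.+1 - a)%N; lia.
have [t Et] : exists t, (j.+1 = b + t)%N by exists (j.+1 - b)%N; lia.
have [r Er] : exists r, (a + b = j + r)%N by exists (a + b - j)%N; lia.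
have -> : (j.+1 ^ 2 * (x' * y' * u) = (j.+1 * x') * (j.+1 * y') * u)%N by ring.
have -> : (b.+1 ^ 2 * (x * z * (v + u)) = b.+1 * (b.+1 * z) * x * (v + u))%N by ring.
rewrite e1 e2 e3.
have -> : (j.+1 - a = s)%N by lia.
have -> : (j.+1 - b = t)%N by lia.
have {}e4 : (j.+1 * v = r * u)%N by rewrite e4; congr (_ * _)%N; lia.
have Eb : (b.+1 = r + s)%N by lia.
have -> : ((j + b).+2 = j.+1 + b.+1)%N by lia.
suff e : (b.+1 * (v + u) = s * u + (j.+1 + b.+1) * v)%N.
  by transitivity (t * x * y * (b.+1 * (v + u)))%N; [ring | rewrite e; ring].
rewrite [in RHS]mulnDl e4 Eb; ring.
Qed.

(** As functions of [h], the [legendre_coef h j] are multiples of the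
    polynomials [\prod_(r < j) (X - r (r + 1))] in [X = h (h + 1)], so products
    of two of them expand linearly in the family.  Raising [b] multiplies,
    up to the factor [(b + 1)^2], by
    [X - b (b + 1) = (X - j (j + 1)) + (j - b) (j + b + 1)]: the first part
    moves the [j]-th term to [j + 1], the second rescales it. *)
Lemma legendre_linearization h a b :
  (legendre_coef h a * legendre_coef h b
   = \sum_(j < h.+1) 'C(j, a) * 'C(j, b) * 'C(a + b, j) * legendre_coef h j)%N.
Proof.
elim: b => [|b IHb].
  rewrite {2}/legendre_coef !bin0 muln1 muln1.
  have [lt|le] := ltnP h a.
    rewrite /legendre_coef bin_small // mul0n big1 // => j _.
    by rewrite bin_small //; have := ltn_ord j; lia.
  rewrite (bigD1 (inord a)) //= inordK // addn0 !binn !bin0 !mul1n big1 ?addn0 // => j.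
  rewrite -val_eqE /= inordK // => nja.
  have [ltj|ltj] := ltnP j a; first by rewrite bin_small.
  by rewrite (@bin_small a j) ?muln0 //; lia.
apply/eqP; rewrite -(@eqn_pmul2l (b.+1 ^ 2)) //; apply/eqP.
rewrite mulnCA legendre_coefS mulnCA IHb.
pose c b j := ('C(j, a) * 'C(j, b) * 'C(a + b, j))%N.
have split_term (j : 'I_h.+1) :
  ((h - b) * (h + b).+1 * (c b j * legendre_coef h j)
   = j.+1 ^ 2 * c b j * legendre_coef h j.+1
     + (j - b) * (j + b).+1 * c b j * legendre_coef h j)%N.
  have [ltj|lebj] := ltnP j b; first by rewrite /c (bin_small ltj) !(muln0, mul0n).
  have -> : (j.+1 ^ 2 * c b j * legendre_coef h j.+1
             = c b j * (j.+1 ^ 2 * legendre_coef h j.+1))%N by ring.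
  rewrite legendre_coefS.
  have lejh : (j <= h)%N by rewrite -ltnS.
  have [s Es] : exists s, (h = j + s)%N by exists (h - j)%N; lia.
  have [t Et] : exists t, (j = b + t :> nat)%N by exists (j - b)%N; lia.
  have -> : (h - b = s + t)%N by lia.
  have -> : (h - j = s)%N by lia.
  have -> : (j - b = t)%N by lia.
  have -> : (h + b).+1 = (b + b + t + s).+1 by lia.
  have -> : (h + j).+1 = (b + b + t + t + s).+1 by lia.
  have -> : (j + b).+1 = (b + b + t).+1 by lia.
  by ring.
rewrite !big_distrr /=.
under eq_bigr => j _ do rewrite split_term.
rewrite big_split /= big_ord_recr /= {2}/legendre_coef bin_small // mul0n muln0 addn0.
rewrite [X in (_ + X)%N]big_ord_recl [RHS]big_ord_recl /=.
rewrite sub0n !mul0n add0n -big_split /= [in 'C(0, b.+1)]bin0n !(muln0,mul0n) add0n.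
apply: eq_bigr => j _; rewrite mulnA [in RHS]linearization_coefS mulnDl.
by rewrite /bump /= add1n /c addSn.
Qed.

(** * The product formula for Hasse polynomials *)

(** Stated with an arbitrary bound [N], so that the expansions for different
    exponents can be summed over one common range. *)
Lemma exprDn_widen (R : comPzRingType) (x y : R) n N : (n < N)%N ->
  (x + y) ^+ n = \sum_(i < N) 'C(n, i)%:R * (x ^+ (n - i) * y ^+ i).
Proof.
move=> ltnN; rewrite exprDn.
rewrite (big_ord_widen _ (fun i : nat => x ^+ (n - i) * y ^+ i *+ 'C(n, i)) ltnN).
rewrite big_mkcond; apply: eq_bigr => i _; rewrite mulr_natl.
by case: ltnP => // lt; rewrite bin_small.
Qed.

Lemma coef_exp_1DZX (R : comNzRingType) (c : R) n m :
  ((1 + c *: 'X) ^+ n)`_m = 'C(n, m)%:R * c ^+ m.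
Proof.
rewrite exprDn.
have -> : \sum_(i < n.+1) 1 ^+ (n - i) * (c *: 'X) ^+ i *+ 'C(n, i)
          = \poly_(i < n.+1) ('C(n, i)%:R * c ^+ i).
  rewrite poly_def; apply: eq_bigr => i _.
  by rewrite expr1n mul1r exprZn -scaler_nat scalerA.
by rewrite coef_poly; case: ltnP => // lt; rewrite bin_small // mul0r.
Qed.

Lemma coef_exp_1DX (R : comNzRingType) n m :
  ((1 + 'X : {poly R}) ^+ n)`_m = 'C(n, m)%:R.
Proof. by rewrite -['X]scale1r coef_exp_1DZX expr1n mulr1. Qed.

Definition hasse (R : pzRingType) (h : nat) (t : R) : R :=
  \sum_(i < h.+1) 'C(h, i)%:R ^+ 2 * t ^+ i.

(** Kept as a coefficient of ['X^j], since the proof uses two unrelated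
    expansions of the same power.  It equals
    [(s - t)^j P_j((s + t) / (s - t))], with [P_j] the Legendre polynomial. *)
Definition central_coef (R : nzRingType) (s t : R) (j : nat) : R :=
  (((1 + s *: 'X) * (1 + t *: 'X)) ^+ j)`_j.

(** Expansion around ['X = -1], from [1 + t 'X = (1 - t) + t (1 + 'X)]. *)
Lemma exp_1DZX_shift (R : comNzRingType) (t : R) n N : (n < N)%N ->
  (1 + t *: 'X) ^+ n
  = \sum_(a < N) ('C(n, a)%:R * (t ^+ a * (1 - t) ^+ (n - a))) *: (1 + 'X) ^+ a.
Proof.
have -> : 1 + t *: 'X = (1 - t)%:P + t *: (1 + 'X) :> {poly R}.
  by rewrite -!mul_polyC polyCB polyC1; ring.
move/exprDn_widen ->; apply: eq_bigr => a _.
rewrite -[in RHS]mul_polyC !polyCM polyC_natr !polyC_exp exprZn -mul_polyC.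
rewrite polyC_exp; ring.
Qed.

(** Both sides are the coefficient of ['X^h] in [(1 + t 'X)^h (1 + 'X)^h]; it is
    the change of variable [(1 + t) / (1 - t)] between the Hasse and the
    Legendre polynomials, with denominators cleared so that [t = 1] is
    allowed. *)
Lemma hasse_legendre (R : comNzRingType) h (t : R) :
  hasse h t
  = \sum_(a < h.+1) (legendre_coef h a)%:R * (t ^+ a * (1 - t) ^+ (h - a)).
Proof.
transitivity (((1 + t *: 'X) ^+ h * (1 + 'X) ^+ h : {poly R})`_h).
  rewrite coefM; apply: eq_bigr => i _.
  rewrite coef_exp_1DZX coef_exp_1DX bin_sub -1?ltnS //; ring.
rewrite (exp_1DZX_shift _ (ltnSn h)) mulr_suml coef_sum; apply: eq_bigr => a _.
rewrite -scalerAl -exprD coefZ coef_exp_1DX /legendre_coef addnC natrM.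
have -> : 'C(h + a, h) = 'C(h + a, a) by rewrite -bin_sub ?leq_addr // addKn.
by ring.
Qed.

Lemma central_coef_sum (R : comNzRingType) (s t : R) j N : (j < N)%N ->
  central_coef s t j
  = \sum_(a < N) \sum_(b < N) ('C(j, a) * 'C(j, b) * 'C(a + b, j))%:R
      * (s ^+ a * (1 - s) ^+ (j - a)) * (t ^+ b * (1 - t) ^+ (j - b)).
Proof.
move=> ltjN; rewrite /central_coef exprMn !(exp_1DZX_shift _ ltjN).
rewrite mulr_suml coef_sum; apply: eq_bigr => a _.
rewrite mulr_sumr coef_sum; apply: eq_bigr => b _.
rewrite -scalerAl -scalerAr -exprD !coefZ coef_exp_1DX !natrM; ring.
Qed.

(** Expand by [(1 + x^2 'X) (1 + y^2 'X) = (x + y)^2 'X + (1 - x y 'X)^2]. *)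
Lemma central_coef_sqr (R : comNzRingType) (x y : R) j N : (j < N)%N ->
  central_coef (x ^+ 2) (y ^+ 2) j
  = \sum_(i < N) 'C(j, i)%:R * ((x + y) ^+ 2) ^+ (j - i) * (- (x * y)) ^+ i
      * 'C(i.*2, i)%:R.
Proof.
move=> ltjN; rewrite /central_coef.
have -> : (1 + x ^+ 2 *: 'X) * (1 + y ^+ 2 *: 'X)
   = (x + y) ^+ 2 *: 'X + (1 + (- (x * y)) *: 'X) ^+ 2 :> {poly R}.
  rewrite -!mul_polyC polyCN polyCM !polyC_exp polyCD; ring.
rewrite (exprDn_widen _ _ ltjN) coef_sum; apply: eq_bigr => i _.
rewrite mulr_natl coefMn exprZn -scalerAl coefZ coefXnM -(exprM (1 + _)) mul2n.
have [ltji|leij] := ltnP j i; first by rewrite bin_small // mulr0n !mul0r.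
rewrite ltnNge leq_subr /= subKn // coef_exp_1DZX -mulr_natl; ring.
Qed.

(** Product formula for Legendre polynomials in homogeneous form: linearize the
    products of Legendre coefficients; for each [j] the resulting double sum
    over [a] and [b] is that of [central_coef_sum]. *)
Lemma hasse_mul (R : comNzRingType) h (s t : R) :
  hasse h s * hasse h t
  = \sum_(j < h.+1) (legendre_coef h j)%:R * ((1 - s) * (1 - t)) ^+ (h - j)
                    * central_coef s t j.
Proof.
rewrite !hasse_legendre big_distrl /=.
under [RHS]eq_bigr => j _ do rewrite (central_coef_sum _ _ (ltn_ord j)) big_distrr /=.
rewrite [RHS]exchange_big /=; apply: eq_bigr => a _.
rewrite big_distrr /=.
under [RHS]eq_bigr => j _ do rewrite big_distrr /=.
rewrite [RHS]exchange_big /=; apply: eq_bigr => b _.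
transitivity ((legendre_coef h a * legendre_coef h b)%:R
   * (s ^+ a * (1 - s) ^+ (h - a)) * (t ^+ b * (1 - t) ^+ (h - b))).
  by rewrite natrM; ring.
rewrite legendre_linearization natr_sum !big_distrl; apply: eq_bigr => j _ /=.
have [ltja|leaj] := ltnP j a; first by rewrite (bin_small ltja) !mul0n; ring.
have [ltjb|lebj] := ltnP j b; first by rewrite (bin_small ltjb) muln0 !mul0n; ring.
have lejh : (j <= h)%N by rewrite -ltnS.
have e (c : nat) : (c <= j)%N -> (h - c = (h - j) + (j - c))%N by lia.
rewrite (e _ leaj) (e _ lebj) !exprD exprMn !natrM; ring.
Qed.

(** * The product formula in characteristic 2h + 1 *)

Lemma pchar_natr_neq0 (F : fieldType) h j :
  h.*2.+1 \in [pchar F] -> (j < h)%N -> j.+1%:R != 0 :> F.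
Proof.
move=> charF ltjh; rewrite -(dvdn_pcharf charF); apply/negP => /dvdn_leq.
by move/(_ isT); lia.
Qed.

Lemma pchar_doubleS (F : fieldType) h :
  h.*2.+1 \in [pchar F] -> h%:R + h%:R + 1 = 0 :> F.
Proof. by move=> charF; rewrite -natrD addnn natr1; apply: pcharf0. Qed.

(** Since [h + 1 + r = - (h - r)] in [F], the rising factorial in the numerator
    on the left is, up to sign, the falling one on the right. *)
Lemma bin_addr_pchar (F : fieldType) h j :
  h.*2.+1 \in [pchar F] -> (j <= h)%N ->
  'C(h + j, j)%:R = (-1) ^+ j * 'C(h, j)%:R :> F.
Proof.
move=> charF; elim: j => [|j IHj] ltjh; first by rewrite !bin0 expr0 mul1r.
have nz := pchar_natr_neq0 charF ltjh.
have hF := pchar_doubleS charF.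
apply: (mulfI nz); rewrite mulrCA -!natrM addnS -mul_bin_diag mul_bin_left /=.
rewrite !natrM IHj ?(ltnW ltjh) // natrB ?(ltnW ltjh) // exprS -natr1 natrD.
have -> : h%:R + j%:R + 1 = - (h%:R - j%:R) :> F.
  by rewrite -[RHS]add0r -hF; ring.
ring.
Qed.

(** In [F] the number [h] is [- 1 / 2], and ['C(2 i, i) = (-4)^i 'C(- 1 / 2, i)]
    holds for the generalized binomial coefficient. *)
Lemma bin_double_pchar (F : fieldType) h i :
  h.*2.+1 \in [pchar F] -> (i <= h)%N ->
  'C(i.*2, i)%:R = (- 4) ^+ i * 'C(h, i)%:R :> F.
Proof.
move=> charF; elim: i => [|i IHi] ltih; first by rewrite !bin0 expr0 mul1r.
have nz := pchar_natr_neq0 charF ltih.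
have hF := pchar_doubleS charF.
apply: (mulfI nz); rewrite mulrCA -!natrM (mul_bin_left h).
have -> : (i.+1 * 'C(i.+1.*2, i.+1) = 2 * (i.*2.+1 * 'C(i.*2, i)))%N.
  have e1 := mul_bin_diag i.+1.*2 i; have e2 := mul_bin_down i.*2.+1 i.
  rewrite doubleS /= in e1 e2 *.
  have e3 : (i.*2.+1 - i = i.+1)%N by lia.
  rewrite e3 in e2; nia.
rewrite !natrM IHi ?(ltnW ltih) // natrB ?(ltnW ltih) // exprS.
have -> : i.*2.+1%:R = - 2 * (h%:R - i%:R) :> F.
  by rewrite -[RHS]add0r -hF -natr1 -addnn natrD; ring.
ring.
Qed.

(** The parametrization of [z1] and [z2] enters through
    [(4 x y)^i ((1 - x^2) (1 - y^2))^(h - j) S^(j - i)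
     = z1^i (- z2)^(h - j) S^h] with [S = (x + y)^2], and [S^h = 1]. *)
Lemma hasse_mul_pchar (F : fieldType) h (x y z1 z2 : F) :
  h.*2.+1 \in [pchar F] -> (x + y) ^+ h.*2 = 1 ->
  z1 * (x + y) ^+ 2 = 4 * x * y ->
  z2 * (x + y) ^+ 2 = - ((x ^+ 2 - 1) * (y ^+ 2 - 1)) ->
  hasse h (x ^+ 2) * hasse h (y ^+ 2)
  = (-1) ^+ h * \sum_(j < h.+1) \sum_(i < h.+1)
      ('C(h, j) * 'C(j, i) * 'C(h, i) * 'C(h, j))%:R * z1 ^+ i * z2 ^+ (h - j).
Proof.
move=> charF xy1 z1E z2E; rewrite hasse_mul big_distrr; apply: eq_bigr => j _ /=.
have lejh : (j <= h)%N by rewrite -ltnS.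
rewrite (central_coef_sqr _ _ (ltn_ord j)) !big_distrr; apply: eq_bigr => i _ /=.
have leih : (i <= h)%N by rewrite -ltnS.
have [ltji|leij] := ltnP j i; first by rewrite (bin_small ltji) muln0 !mul0n !(mul0r, mulr0).
rewrite /legendre_coef !natrM (bin_addr_pchar charF) // (bin_double_pchar charF) //.
set S := (x + y) ^+ 2 in z1E z2E *.
have Sh : S ^+ (h - j) * S ^+ (j - i) * S ^+ i = 1.
  by rewrite -!exprD -exprM -xy1; congr (_ ^+ _); lia.
clearbody S.
have -> : (1 - x ^+ 2) * (1 - y ^+ 2) = - 1 * z2 * S.
  by rewrite -mulrA z2E; ring.
have e4 : (- (x * y)) ^+ i * (- 4) ^+ i = z1 ^+ i * S ^+ i.
  by rewrite -!exprMn z1E; congr (_ ^+ _); ring.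
have e1 : (-1) ^+ j * (-1) ^+ (h - j) = (-1) ^+ h :> F by rewrite -exprD subnKC.
rewrite !exprMn.
transitivity (((-1) ^+ j * (-1) ^+ (h - j)) * ((- (x * y)) ^+ i * (- 4) ^+ i)
   * (S ^+ (h - j) * S ^+ (j - i)) * 'C(h, j)%:R ^+ 2 * 'C(j, i)%:R
   * 'C(h, i)%:R * z2 ^+ (h - j)); first by ring.
rewrite e1 e4 -[RHS]mul1r -Sh; ring.
Qed.

(** * Evaluation of the two multinomial sums *)

(** Choose first which elements fall into the classes [x] and [z] together.
    This grouping makes the convolutions below instances of Vandermonde's. *)
Lemma multinomial4E h (x y z w : nat) : (x + y + z + w = h)%N ->
  multinomial h [:: x%:Z; y%:Z; z%:Z; w%:Z]
  = ('C(h, x + z) * ('C(x + z, z) * 'C(y + w, y)))%N.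
Proof.
move=> hE; rewrite /multinomial /= !big_cons big_nil muln1 !absz_nat.
have e1 : ('C(h, x + z) * ((x + z)`! * (y + w)`!) = h`!)%N.
  have -> : (y + w = h - (x + z))%N by lia.
  by apply: bin_fact; lia.
have e2 := bin_fact (leq_addl x z); rewrite addnK in e2.
have e3 := bin_fact (leq_addr w y); rewrite addKn in e3.
rewrite -e1 -e2 -e3.
set c1 := 'C(h, _); set c2 := 'C(x + z, z); set c3 := 'C(y + w, y).
have -> : (c1 * (c2 * (z`! * x`!) * (c3 * (y`! * w`!)))
  = c1 * (c2 * c3) * (x`! * (y`! * (z`! * w`!))))%N by ring.
by rewrite mulnK // !muln_gt0 !fact_gt0.
Qed.

Lemma multinomial3E h (x y z : nat) : (x + y + z = h)%N ->
  multinomial h [:: x%:Z; y%:Z; z%:Z] = ('C(h, y) * 'C(h - y, x))%N.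
Proof.
move=> hE.
have -> : multinomial h [:: x%:Z; y%:Z; z%:Z] = multinomial h [:: 0%N%:Z; x%:Z; y%:Z; z%:Z].
  by rewrite /multinomial /= !big_cons fact0 mul1n.
rewrite multinomial4E ?add0n ?binn //; by rewrite mul1n; congr (_ * 'C(_, _))%N; lia.
Qed.

Lemma sum_complement (V : nmodType) (F : nat -> V) s h :
  \sum_(l < h.+1 | (s + l == h)%N) F l = if (s <= h)%N then F (h - s)%N else 0.
Proof.
case: ifP => [lesh|ltsh]; last by rewrite big1 // => l /eqP; lia.
have lt : (h - s < h.+1)%N by rewrite ltnS leq_subr.
rewrite (big_pred1 (Ordinal lt)) // => l /=.
by rewrite -val_eqE /=; lia.
Qed.

Lemma sum_shift (V : nmodType) (F : nat -> V) N k :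
  (forall n, (N <= n)%N -> F n = 0) ->
  \sum_(i < N) F (i + k)%N = \sum_(n < N | (k <= n)%N) F n.
Proof.
move=> F0; pose G n := if (k <= n)%N then F n else 0.
transitivity (\sum_(n < k + N) G n).
  rewrite big_split_ord /= [X in X + _]big1 ?add0r; last first.
    by move=> n _; rewrite /G leqNgt ltn_ord.
  by apply: eq_bigr => n _; rewrite /G leq_addr addnC.
rewrite addnC big_split_ord /= [X in _ + X]big1 ?addr0; last first.
  by move=> n _; rewrite /G F0 ?leq_addr // if_same.
by rewrite [RHS]big_mkcond.
Qed.

Lemma Vandermonde_widen m l b N : (b < N)%N ->
  (\sum_(k < N | k <= b) 'C(m, k) * 'C(l, b - k) = 'C(m + l, b))%N.
Proof.
by move=> ltbN; rewrite -binomial.Vandermonde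
  (big_ord_widen _ (fun k => 'C(m, k) * 'C(l, b - k))%N ltbN).
Qed.

(** By [multinomial4E] the grouped sizes [(m - i) + (n - k) = j + l] and
    [(m - j) + (n - l) = i + k] do not depend on [m]; in terms of [t = m - j]
    the sum is a Vandermonde convolution with value ['C(h, i + l)]. *)
Lemma sum_multinomial_shifted h (i j k l : nat) : (i + j + k + l = h)%N ->
  (\sum_(m < h.+1) multinomial h
     [:: m%:Z - i%:Z; m%:Z - j%:Z; (h - m)%N%:Z - k%:Z; (h - m)%N%:Z - l%:Z]%R
   = 'C(h, i + k) * 'C(h, j + k))%N.
Proof.
move=> hE.
pose F t := (if t <= i + l then 'C(h, i + k) * ('C(i + k, t) * 'C(j + l, i + l - t)) else 0)%N.
transitivity (\sum_(m < h.+1 | (j <= m)%N) F (m - j)%N)%N; last first.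
  rewrite -(@sum_shift _ (fun m => F (m - j)%N)); last first.
    by move=> n lthn; rewrite /F; case: ifP => //; lia.
  under eq_bigr => t _ do rewrite addnK.
  rewrite -big_mkcond -big_distrr /= Vandermonde_widen; last by lia.
  rewrite -[X in _ = (_ * X)%N]bin_sub; last by lia.
  by congr (_ * 'C(_, _))%N; lia.
rewrite [RHS]big_mkcond; apply: eq_bigr => m _ /=.
have lemh : (m <= h)%N by rewrite -ltnS.
have [lejm|ltmj] := leqP j m; last first.
  by rewrite /multinomial /=; case: ifP => //; lia.
rewrite /F; have [letil|ltilt] := leqP (m - j) (i + l); last first.
  by rewrite /multinomial /=; case: ifP => //; lia.
have [ltmi|leim] := ltnP m i.
  rewrite [X in (_ * (_ * X))%N]bin_small; last by lia.
  by rewrite !muln0 /multinomial /=; case: ifP => //; lia.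
have [ltnl|lenl] := ltnP (h - m) l.
  rewrite [X in (_ * (X * _))%N]bin_small; last by lia.
  by rewrite !muln0 /multinomial /=; case: ifP => //; lia.
have -> : m%:Z - i%:Z = (m - i)%N%:Z by lia.
have -> : m%:Z - j%:Z = (m - j)%N%:Z by lia.
have -> : (h - m)%N%:Z - k%:Z = (h - m - k)%N%:Z by lia.
have -> : (h - m)%N%:Z - l%:Z = (h - m - l)%N%:Z by lia.
rewrite multinomial4E; last by lia.
rewrite -bin_sub; last by lia.
have -> : (m - i + (h - m - k) = j + l)%N by lia.
have -> : (m - j + (h - m - l) = i + k)%N by lia.
have -> : (h - m - k = i + l - (m - j))%N by lia.
have -> : (h - (j + l) = i + k)%N by lia.
by rewrite [('C(i + k, _) * _)%N]mulnC.
Qed.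

Lemma lhs_sum_hasse h (k1 k2 : rat) :
  lhs_sum h k1 k2 = hasse h (k1 ^+ 2) * hasse h (k2 ^+ 2).
Proof.
rewrite /lhs_sum; move: (k1 ^+ 2) (k2 ^+ 2) => A B.
(* The summand after summation over [m] and [n], with [a = i + k] and [b = j + k].
   It vanishes when [i + j + k > h], so [i], [j], [k] range independently. *)
pose G a b k : rat := ('C(h, a) * 'C(a, k) * 'C(h - a, b - k) * ('C(h, a) * 'C(h, b)))%:R
  * A ^+ a * B ^+ b.
transitivity (\sum_(i < h.+1) \sum_(j < h.+1) \sum_(k < h.+1) G (i + k)%N (j + k)%N k).
  pose T (m n i j k l : nat) : rat :=
    (multinomial h [:: i%:Z; j%:Z; k%:Z; l%:Z])%:R
        * (multinomial h [:: m%:Z - i%:Z; m%:Z - j%:Z;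
                             n%:Z - k%:Z; n%:Z - l%:Z])%:R
        * A ^+ i * B ^+ j * (A * B) ^+ k.
  transitivity (\sum_(m < h.+1) \sum_(i < h.+1) \sum_(j < h.+1) \sum_(k < h.+1)
      if (i + j + k <= h)%N then T m (h - m)%N i j k (h - (i + j + k))%N else 0).
    apply: eq_bigr => m _; have lemh : (m <= h)%N by rewrite -ltnS.
    rewrite (@sum_complement _ (fun n => \sum_(i < h.+1) \sum_(j < h.+1) \sum_(k < h.+1)
      \sum_(l < h.+1 | (i + j + k + l == h)%N) T m n i j k l)) lemh.
    do 3 (apply: eq_bigr => ? _); exact: sum_complement.
  rewrite exchange_big; apply: eq_bigr => i _.
  rewrite exchange_big; apply: eq_bigr => j _.
  rewrite exchange_big; apply: eq_bigr => k _ /=.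
  case: leqP => [le_h|lt_h]; last first.
    rewrite big1 // /G; have [ltha|leah] := ltnP h (i + k).
      by rewrite [in 'C(h, i + k)]bin_small // !mul0n !mul0r.
    by rewrite [in 'C(h - _, _)]bin_small ?muln0 ?mul0n ?mul0r //; lia.
  rewrite /T -!big_distrl -big_distrr -natr_sum /=.
  rewrite sum_multinomial_shifted ?subnKC // multinomial4E ?subnKC // -natrM /G.
  rewrite addnK mulnA; have -> : (h - (i + k) = j + (h - (i + j + k)))%N by lia.
  by rewrite exprMn !exprD !natrM; ring.
(* Reindex by [a = i + k] and [b = j + k], which leaves a convolution in [k]. *)
have bin_gt (n : nat) : (h.+1 <= n)%N -> 'C(h, n) = 0%N by apply: bin_small.
under eq_bigr => i _ do rewrite exchange_big.
rewrite exchange_big /=.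
transitivity (\sum_(k < h.+1) \sum_(a < h.+1 | (k <= a)%N) \sum_(b < h.+1 | (k <= b)%N) G a b k).
  apply: eq_bigr => k _.
  transitivity (\sum_(i < h.+1) \sum_(b < h.+1 | (k <= b)%N) G (i + k)%N b k).
    apply: eq_bigr => i _; apply: (@sum_shift _ (fun b => G (i + k)%N b k)) => n /bin_gt h0.
    by rewrite /G h0 !muln0 !mul0r.
  apply: (@sum_shift _ (fun a => \sum_(b < h.+1 | (k <= b)%N) G a b k)) => n /bin_gt h0.
  by rewrite big1 // => b _; rewrite /G h0 !mul0n !mul0r.
rewrite (exchange_big_dep xpredT) //= /hasse big_distrl; apply: eq_bigr => a _ /=.
rewrite (exchange_big_dep xpredT) //= big_distrr; apply: eq_bigr => b _ /=.
transitivity ((\sum_(k < h.+1 | (k <= b)%N) 'C(a, k) * 'C(h - a, b - k))%:R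
   * (('C(h, a) * 'C(h, a) * 'C(h, b))%:R * A ^+ a * B ^+ b)).
  rewrite natr_sum big_distrl big_mkcond [RHS]big_mkcond; apply: eq_bigr => k _ /=.
  case: (leqP k b) => // _; rewrite ?andbF ?andbT //.
  case: leqP => [leka|ltak]; first by rewrite /G !natrM; ring.
  by rewrite (bin_small ltak) mul0n mul0r.
have leah : (a <= h)%N by rewrite -ltnS.
by rewrite Vandermonde_widen ?ltn_ord // subnKC // !natrM; ring.
Qed.

Lemma rhs_sumE h (z1 z2 : rat) :
  rhs_sum h z1 z2
  = (-1) ^+ h * \sum_(j < h.+1) \sum_(i < h.+1)
      ('C(h, j) * 'C(j, i) * 'C(h, i) * 'C(h, j))%:R * z1 ^+ i * z2 ^+ (h - j).
Proof.
rewrite /rhs_sum; congr (_ * _); rewrite [RHS](reindex_inj rev_ord_inj) exchange_big /=.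
apply: eq_bigr => j _; apply: eq_bigr => i _.
have lejh : (j <= h)%N by rewrite -ltnS.
rewrite (@sum_complement _ (fun k => (multinomial h [:: i%:Z; j%:Z; k%:Z])%:R
    * 'C(h, i)%:R * 'C(h, j)%:R * z1 ^+ i * z2 ^+ j)) subSS subKn // bin_sub //.
case: leqP => [leij|ltij].
  by rewrite multinomial3E ?subnKC // !natrM.
by rewrite (@bin_small (h - j)) ?muln0 ?mul0n ?mul0r //; lia.
Qed.

(** * Reduction modulo p *)

(** The reduction homomorphism from Z_(p) to ['F_p], as a relation on rationals:
    [ratr] is additive and multiplicative only on p-integral arguments, so
    integrality has to be carried along with the value. *)
Definition reduces_to (p : nat) (x : rat) (y : 'F_p) : Prop :=
  p_integral p x /\ ratr x = y.

Lemma Fp_intr_neq0 p (d : int) : prime p -> coprime p `|d| ->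
  d%:~R != 0 :> 'F_p.
Proof.
move=> p_pr; rewrite prime_coprime //.
case: d => n ndiv; rewrite ?NegzE ?rmorphN ?oppr_eq0 /= -pmulrn;
  by rewrite -(dvdn_pcharf (pchar_Fp p_pr)).
Qed.

(** A fraction need not be in lowest terms: any denominator prime to [p]
    computes the reduction.  This yields the compatibility with sums and
    products. *)
Lemma reduces_frac p (x : rat) (y : 'F_p) (n d : int) :
  prime p -> coprime p `|d| -> x * d%:~R = n%:~R -> y * d%:~R = n%:~R ->
  reduces_to x y.
Proof.
move=> p_pr co_pd xE yE.
have numE : numq x * d = n * denq x.
  by apply: (intr_inj (R := rat)); rewrite !intrM numqE -xE; ring.
have den_dvd : (`|denq x| %| `|d|)%N.
  rewrite -(@Gauss_dvdr _ `|numq x|) -?abszM ?numE ?abszM ?dvdn_mull //.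
  by rewrite coprime_sym coprime_num_den.
have x_int : p_integral p x by apply: coprime_dvdr co_pd.
split=> //; rewrite /ratr.
have den_nz := Fp_intr_neq0 p_pr x_int; have d_nz := Fp_intr_neq0 p_pr co_pd.
apply: (mulIf d_nz); apply: (mulIf den_nz).
by rewrite mulrAC divfK // -intrM numE intrM -yE.
Qed.

Lemma reduces_numq p x (y : 'F_p) : prime p -> reduces_to x y ->
  y * (denq x)%:~R = (numq x)%:~R.
Proof. by move=> p_pr [x_int <-]; rewrite divfK // Fp_intr_neq0. Qed.

Section Reduction.
Variables (p : nat) (p_pr : prime p).
Implicit Types (x : rat) (y : 'F_p).

Lemma reduces_int (n : int) : reduces_to n%:~R (n%:~R : 'F_p).
Proof. by apply: (@reduces_frac p _ _ n 1) => //; rewrite ?coprimen1 ?mulr1. Qed.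

Lemma reduces_nat (n : nat) : reduces_to n%:R (n%:R : 'F_p).
Proof. exact: reduces_int n. Qed.

Lemma reduces_add x1 x2 y1 y2 :
  reduces_to x1 y1 -> reduces_to x2 y2 -> reduces_to (x1 + x2) (y1 + y2).
Proof.
move=> r1 r2; have e1 := reduces_numq p_pr r1; have e2 := reduces_numq p_pr r2.
apply: (@reduces_frac _ _ _ (numq x1 * denq x2 + numq x2 * denq x1)
  (denq x1 * denq x2)) => //.
- by rewrite abszM coprimeMr; apply/andP; split; [exact: r1.1 | exact: r2.1].
- by rewrite intrD !intrM !numqE; ring.
- by rewrite intrD !intrM -e1 -e2; ring.
Qed.

Lemma reduces_mul x1 x2 y1 y2 :
  reduces_to x1 y1 -> reduces_to x2 y2 -> reduces_to (x1 * x2) (y1 * y2).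
Proof.
move=> r1 r2; have e1 := reduces_numq p_pr r1; have e2 := reduces_numq p_pr r2.
apply: (@reduces_frac _ _ _ (numq x1 * numq x2) (denq x1 * denq x2)) => //.
- by rewrite abszM coprimeMr; apply/andP; split; [exact: r1.1 | exact: r2.1].
- by rewrite !intrM !numqE; ring.
- by rewrite !intrM -e1 -e2; ring.
Qed.

Lemma reduces_opp x y : reduces_to x y -> reduces_to (- x) (- y).
Proof.
by move=> r; rewrite -mulN1r -[- y]mulN1r; apply: reduces_mul (reduces_int (-1)) r.
Qed.

Lemma reduces_exp x y n : reduces_to x y -> reduces_to (x ^+ n) (y ^+ n).
Proof.
move=> r; elim: n => [|n IHn]; first exact: reduces_nat 1%N.
by rewrite !exprS; apply: reduces_mul.
Qed.

Lemma reduces_sum (I : Type) (s : seq I) (P : pred I) (F : I -> rat) (G : I -> 'F_p) :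
  (forall i, reduces_to (F i) (G i)) ->
  reduces_to (\sum_(i <- s | P i) F i) (\sum_(i <- s | P i) G i).
Proof.
move=> r; apply: (big_ind2 (@reduces_to p)) => //; first exact: reduces_nat 0%N.
by move=> ? ? ? ?; apply: reduces_add.
Qed.

Lemma reduces_uniq x y1 y2 : reduces_to x y1 -> reduces_to x y2 -> y1 = y2.
Proof. by move=> [_ <-] [_ <-]. Qed.

Lemma reduces_ratr x : p_integral p x -> reduces_to x (ratr x : 'F_p).
Proof. by []. Qed.

Lemma reduces_hasse h x y : reduces_to x y -> reduces_to (hasse h x) (hasse h y).
Proof.
move=> r; apply: reduces_sum => i.
by apply: reduces_mul (reduces_exp _ r); apply/reduces_exp/reduces_nat.
Qed.

End Reduction.

(** * The congruence *)

Theorem theorem1p2 (p : nat) (k1 k2 z1 z2 : rat)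
    (p_prime : prime p) (p_odd : odd p)
    (k1k2_neq0 : k1 + k2 != 0)
    (z1E : z1 = 4 * k1 * k2 / (k1 + k2) ^+ 2)
    (z2E : z2 = - ((k1 ^+ 2 - 1) * (k2 ^+ 2 - 1) / (k1 + k2) ^+ 2))
    (k1_int : p_integral p k1) (k2_int : p_integral p k2)
    (z1_int : p_integral p z1) (z2_int : p_integral p z2) :
  eq_modp p (lhs_sum (p - 1)./2 k1 k2) (rhs_sum (p - 1)./2 z1 z2).
Proof.
set h := (p - 1)./2.
have pE : p = h.*2.+1 by rewrite /h; have := prime_gt1 p_prime; lia.
have charF : h.*2.+1 \in [pchar 'F_p] by rewrite -pE pchar_Fp.
have [rk1 rk2] := (reduces_ratr k1_int, reduces_ratr k2_int).
have [rz1 rz2] := (reduces_ratr z1_int, reduces_ratr z2_int).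
move: rk1 rk2 rz1 rz2.
move: (ratr k1 : 'F_p) (ratr k2 : 'F_p) (ratr z1 : 'F_p) (ratr z2 : 'F_p).
move=> x y u v rk1 rk2 rz1 rz2.
have S_nz : (k1 + k2) ^+ 2 != 0 by rewrite expf_neq0.
have rD := reduces_add p_prime; have rM := reduces_mul p_prime.
have rN := reduces_opp p_prime; have rX := reduces_exp p_prime.
have rS : reduces_to ((k1 + k2) ^+ 2) ((x + y) ^+ 2) by apply/rX/rD.
have uE : u * (x + y) ^+ 2 = 4 * x * y.
  apply: (@reduces_uniq p (z1 * (k1 + k2) ^+ 2)); first exact: rM.
  by rewrite z1E divfK //; do 2 apply: (rM) => //; apply: (reduces_nat p_prime).
have vE : v * (x + y) ^+ 2 = - ((x ^+ 2 - 1) * (y ^+ 2 - 1)).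
  apply: (@reduces_uniq p (z2 * (k1 + k2) ^+ 2)); first exact: rM.
  rewrite z2E mulNr divfK //; apply: (rN).
  have r1 : reduces_to (- 1) (- 1 : 'F_p) := rN _ _ (reduces_nat p_prime 1).
  by apply: (rM); apply: (rD) => //; apply: (rX).
(* Otherwise [4 x y = 0] forces [x = y = 0], and [vE] would read [0 = -1]. *)
have xy_nz : x + y != 0.
  apply/eqP => xy0; move: uE vE; rewrite xy0 expr0n !mulr0.
  have -> : y = - x by apply/eqP; rewrite -addr_eq0 addrC xy0.
  move/esym/eqP; rewrite mulrN oppr_eq0 -mulrA mulf_eq0 mulf_eq0 orbb.
  case/orP => [|/eqP -> /eqP].
    rewrite -(dvdn_pcharf charF) -pE (@Euclid_dvdX 2 2 p) // => /andP[/dvdn_leq].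
    by move/(_ isT); have := prime_gt1 p_prime; lia.
  rewrite oppr0 expr0n sub0r mulrNN mulr1 eq_sym oppr_eq0.
  by rewrite oner_eq0.
have xy1 : (x + y) ^+ h.*2 = 1.
  apply: (mulfI xy_nz); rewrite -exprS -pE mulr1.
  by rewrite -[in X in _ ^+ X](card_Fp p_prime) expf_card.
have rl : reduces_to (lhs_sum h k1 k2) (hasse h (x ^+ 2) * hasse h (y ^+ 2)).
  by rewrite lhs_sum_hasse; apply: (rM); apply: reduces_hasse => //; apply: (rX).
have [rhs_int rhsE] : reduces_to (rhs_sum h z1 z2)
    (hasse h (x ^+ 2) * hasse h (y ^+ 2)).
  rewrite rhs_sumE (hasse_mul_pchar charF xy1 uE vE).
  apply: (rM); first by apply/rX/rN/(reduces_nat p_prime 1).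
  apply: reduces_sum => // j; apply: reduces_sum => // i.
  by apply: (rM); [apply: (rM); [exact: reduces_nat | exact: rX] | exact: rX].
by case: rl => lhs_int lhsE; split=> //; rewrite lhsE rhsE.
Qed.
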